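(* Let $m\ge 1$ be an integer, let $q=2^m$, let $\mathbb{F}_q$ denote the field with $q$ elements, and let $f(x)=cx^2+ax+b\in\mathbb{F}_q[x]$ be a quadratic polynomial with $c\in\mathbb{F}_q$, $c\neq 0$, and $a,b\in\mathbb{F}_q^*$. Then the third iterate $f(f(f(x)))$ is not an irreducible polynomial over $\mathbb{F}_q$.
   Context: $\mathbb{F}_q^*$ denotes the set of nonzero elements of $\mathbb{F}_q$. *)

(* Defs.v *)
From HB Require Import structures.
From mathcomp Require Import all_boot all_order all_algebra.

Set Implicit Arguments.
Unset Strict Implicit.
Unset Printing Implicit Defensive.

(* Main.v *)
Require Import Defs.
From HB Require Import structures.
From mathcomp Require Import all_boot all_order all_algebra.
From mathcomp Require Import finfield zify ring.

Import GRing.Theory.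
Local Open Scope ring_scope.

(** Substituting [t = c x / a] turns [f] into [T(t) = a (t^2 + t + s)] with
    [s = b c / a^2].  Put [e = 1 / a].  The image of [z |-> z^2 + z] has index 2
    in the additive group, so it contains [s], [e] or [s + e].  If it contains
    [s], then [T] splits; if it contains [e] but not [s], then [T o T] is a
    product of two quadratics.  If it contains neither, let [s + e = d^2 + d]
    and adjoin [w] with [w^2 + w = e]: over [F(w)], which contains the roots
    [w + d], [w + d + 1] of [T], the polynomial [T o T o T] is a product of
    quadratics of the shape [t^2 + s + e^2 + e g + w (t + k) + k] with [g], [k]
    in [F] and of their conjugates, and the norm of such a quadratic is a
    quartic factor over [F]. *)

Lemma irreducible_polyM (F : fieldType) (p q : {poly F}) :
  irreducible_poly (p * q) -> (1 < size p)%N -> (1 < size q)%N -> False.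
Proof.
move=> irr p1 q1; have pq0 := irredp_neq0 irr.
move: (pq0); rewrite mulf_eq0 negb_or => /andP[p0 q0].
have /eqp_size : p %= p * q by apply: irr.2; rewrite ?dvdp_mulr ?gtn_eqF.
rewrite size_mul // => h; move: p1 q1 h.
by case: (size p) => // m; case: (size q) => [|[|n]] // _ _; lia.
Qed.

Lemma coefS_size_gt1 (R : nzSemiRingType) (p : {poly R}) (i : nat) :
  p`_i.+1 != 0 -> (1 < size p)%N.
Proof.
by rewrite ltnNge; apply: contra => p1; rewrite nth_default // (leq_trans p1).
Qed.

Lemma size_comp_poly_gt1 (F : idomainType) (p q : {poly F}) :
  (1 < size p)%N -> (1 < size q)%N -> (1 < size (p \Po q))%N.
Proof.
move=> p1 q1; rewrite -subn_gt0 subn1 size_comp_poly muln_gt0 -!subn1.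
by rewrite !subn_gt0 p1.
Qed.

Section CharTwo.

Variable R : comNzRingType.
Hypothesis R2 : 2 = 0 :> R.

(* [ring: R2] only erases coefficients equal to 2, so the even coefficients 4
   and 6 need rules of their own, and [x = y] is proved as [x + y = 0] to avoid
   odd coefficients. *)
Let R4 : 4 = 0 :> R. Proof. by rewrite -[4%N]/(2 + 2)%N natrD R2 add0r. Qed.

Let R6 : 6 = 0 :> R.
Proof. by rewrite -[6%N]/(4 + 2)%N natrD R2 R4 add0r. Qed.

Let addr2_eq0 (x y : R) : x + y = 0 -> x = y.
Proof. by move=> h; transitivity (x + y + y); [ring: R2 | rewrite h add0r]. Qed.

Let sqrrD2 (x y : R) : (x + y) ^+ 2 = x ^+ 2 + y ^+ 2.
Proof. by ring: R2. Qed.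

Lemma artin_schreier_eq_add1 (x z : R) :
  z ^+ 2 + z = x -> (z + 1) ^+ 2 + (z + 1) = x.
Proof. by move=> <-; apply: addr2_eq0; ring: R2 R4. Qed.

(** If [w ^+ 2 + w = e], then [Q x] is the norm of [A x + w * (t + x)] under [w -> w + 1]; using
    this norm avoids adjoining [w]. The product of the two norms is computed by eliminating [k],
    then [g], then [d]. *)
Lemma third_iterate_factor (a e s d g k t : R) : a * e = 1 ->
    d ^+ 2 + d = s + e -> g ^+ 2 + g = s + e * d ->
    k ^+ 2 + k = e ^+ 3 + e ^+ 2 + s + e * g ->
  let T x := a * (x ^+ 2 + x + s) in
  let A x := t ^+ 2 + s + e ^+ 2 + e * g + x in
  let Q x := A x ^+ 2 + A x * (t + x) + e * (t + x) ^+ 2 in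
  T (T (T t)) = a ^+ 7 * (Q k * Q (k + 1)).
Proof.
move=> ae hd hg hk T A Q; pose p := t ^+ 2 + t + s.
pose q := p ^+ 2 + e * p + s * e ^+ 2.
have TT : T (T t) = a ^+ 3 * q.
  transitivity (a ^+ 3 * p ^+ 2 + a ^+ 2 * (a * e) * p + a * (a * e) ^+ 2 * s).
    by rewrite ae /T /p; ring.
  by rewrite /q; ring.
have -> : T (T (T t)) = a ^+ 7 * (q ^+ 2 + e ^+ 3 * q + s * e ^+ 6).
  rewrite TT; transitivity
    (a ^+ 7 * q ^+ 2 + a ^+ 4 * (a * e) ^+ 3 * q + a * (a * e) ^+ 6 * s).
    by rewrite ae /T; ring.
  by ring.
congr (_ * _).
pose r := g ^+ 2 + g + s.
have hr : r ^+ 2 + e * r = e ^+ 2 * s + e ^+ 3.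
  transitivity ((e * d) ^+ 2 + e * (e * d)).
    have -> : r = e * d by rewrite /r hg; apply: addr2_eq0; ring: R2 R4.
    by [].
  by transitivity (e ^+ 2 * (d ^+ 2 + d)); [ring | rewrite hd; ring].
pose A0 := t ^+ 2 + s + e ^+ 2 + e * g.
pose u := e ^+ 3 + e ^+ 2 + s + e * g.
pose M := A0 ^+ 2 + A0 * t + e * t ^+ 2 + e * u.
pose N := A0 + e + t.
(* Modulo [x ^+ 2 + x = u], [Q x] is linear in [x], so its product over the roots [k], [k + 1]
   involves only [u]. *)
have QE x : x ^+ 2 + x = u -> Q x = M + x * N.
  move=> hx; have -> : Q x = A0 ^+ 2 + A0 * t + e * t ^+ 2 + e * (x ^+ 2 + x)
                             + x * N.
    by rewrite /Q /A /N /A0 !sqrrD2; apply: addr2_eq0; ring: R2 R4.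
  by rewrite hx.
rewrite (QE k) // (QE (k + 1)); last exact: artin_schreier_eq_add1.
have -> : (M + k * N) * (M + (k + 1) * N) =
          M ^+ 2 + M * N + (k ^+ 2 + k) * N ^+ 2.
  by apply: addr2_eq0; ring: R2 R4.
rewrite hk -/u.
(* By [hr] the bracket after [e ^+ 4] is the sum of two equal terms, hence 0. *)
have -> : M ^+ 2 + M * N + u * N ^+ 2 = q ^+ 2 + e ^+ 3 * q + s * e ^+ 6
    + e ^+ 4 * (r ^+ 2 + e * r + (e ^+ 2 * s + e ^+ 3)).
  by rewrite /M /N /q /p /A0 /r /u !sqrrD2; apply: addr2_eq0; ring: R2 R4 R6.
by rewrite hr; apply: addr2_eq0; ring: R2 R4.
Qed.

(** Put [P = t ^+ 2 + w * t + s]. Since [e = w ^+ 2 + w], the iterate is [a ^+ 3] times [P ^+ 2 + (w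
    + 1) * P + (w + 1) ^+ 2 * (s + s * w ^+ 2)], a quadratic in [P] that splits through [y]. *)
Lemma second_iterate_factor (a e s w y t : R) : a * e = 1 ->
    w ^+ 2 + w = e -> y ^+ 2 + y = s + s * w ^+ 2 ->
  let T x := a * (x ^+ 2 + x + s) in
  let Q x := t ^+ 2 + w * t + s + (w + 1) * x in
  T (T t) = a ^+ 3 * (Q y * Q (y + 1)).
Proof.
move=> ae hw hy T Q; pose p := t ^+ 2 + t + s.
have -> : T (T t) = a ^+ 3 * (p ^+ 2 + e * p + s * e ^+ 2).
  transitivity (a ^+ 3 * p ^+ 2 + a ^+ 2 * (a * e) * p + a * (a * e) ^+ 2 * s).
    by rewrite ae /T /p; ring.
  by ring.
congr (_ * _).
have -> : Q y * Q (y + 1) =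
    (t ^+ 2 + w * t + s) ^+ 2 + (w + 1) * (t ^+ 2 + w * t + s)
    + (w + 1) ^+ 2 * (y ^+ 2 + y) by rewrite /Q; apply: addr2_eq0; ring: R2 R4.
by rewrite hy -hw /p; apply: addr2_eq0; ring: R2 R4.
Qed.

End CharTwo.

Section ArtinSchreier.

Variable F : finFieldType.
Hypothesis F2 : 2 = 0 :> F.

Definition artin_schreier : {set F} := [set z ^+ 2 + z | z : F].

Lemma artin_schreierP x :
  reflect (exists z, z ^+ 2 + z = x) (x \in artin_schreier).
Proof.
by apply: (iffP imsetP) => [[z _ ->]|[z <-]]; exists z.
Qed.

Lemma artin_schreierD x y :
  x \in artin_schreier -> y \in artin_schreier -> x + y \in artin_schreier.
Proof.
move=> /artin_schreierP[z <-] /artin_schreierP[v <-].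
by apply/artin_schreierP; exists (z + v); ring: F2.
Qed.

(** The fibre of [z ^+ 2 + z] through [z] lies in the pair [z], [z + 1]. *)
Lemma card_artin_schreier : (#|F| <= 2 * #|artin_schreier|)%N.
Proof.
rewrite -[leqLHS]sum1_card (partition_big_imset (fun z : F => z ^+ 2 + z)) /=.
rewrite [(2 * _)%N]mulnC -sum_nat_const; apply: leq_sum => _ /imsetP[z _ ->].
rewrite sum1_card; apply: (@leq_trans #|[set z; z + 1]|).
  apply/subset_leq_card/subsetP => v; rewrite !inE => /= /eqP vz.
  rewrite -[v == z]subr_eq0 -[v == z + 1]subr_eq0 -mulf_eq0.
  have -> : (v - z) * (v - (z + 1)) =
      v ^+ 2 + v - (z ^+ 2 + z) + 2 * (z ^+ 2 + z - v * z - v) by ring.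
  by rewrite vz subrr F2 mul0r addr0.
by rewrite cards2; case: eqP.
Qed.

(** The translate of the image by [x] avoids the image, and by cardinality it fills the complement,
    so it contains [y]. *)
Lemma artin_schreier_index2 x y :
    x \notin artin_schreier -> y \notin artin_schreier ->
  x + y \in artin_schreier.
Proof.
move=> xI yI; pose D := [set x + v | v in artin_schreier].
have DE : D == ~: artin_schreier.
  rewrite eqEcard; apply/andP; split.
    apply/subsetP => _ /imsetP[v vI ->]; rewrite inE; apply: contra xI => xvI.
    have -> : x = x + v + v by ring: F2.
    exact: artin_schreierD.
  rewrite card_imset; last exact: addrI.
  have := card_artin_schreier.
  by rewrite -(cardsC artin_schreier) mul2n -addnn leq_add2l.
have : y \in D by rewrite (eqP DE) inE.
case/imsetP => v vI ->; have -> // : x + (x + v) = v by ring: F2.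
Qed.

End ArtinSchreier.

Theorem theorem1 (m : nat) (Hm : (1 <= m)%N) (F : finFieldType)
    (HF : #|F| = (2 ^ m)%N) (c a b : F)
    (Hc : c != 0) (Ha : a != 0) (Hb : b != 0) :
  let f : {poly F} := c *: 'X^2 + a *: 'X + b%:P in
  ~ irreducible_poly (f \Po (f \Po f)).
Proof.
have F2 : 2 = 0 :> F.
  by have := card_finPcharP HF isT; rewrite inE => /andP[_ /eqP].
have P2 : 2 = 0 :> {poly F} by rewrite -polyC_natr F2.
move=> f irr.
pose s := b * c / a ^+ 2; pose e := a^-1.
have ae : a%:P * e%:P = 1 by rewrite -polyCM mulfV.
pose T : {poly F} := a%:P * ('X ^+ 2 + 'X + s%:P).
pose l : {poly F} := (c / a) *: 'X.
have sl : size l = 2 by rewrite size_scale ?size_polyX ?mulf_neq0 ?invr_neq0.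
have lf : l \Po f = T \Po l.
  rewrite /l /f /T !(comp_polyM, comp_polyD, comp_polyC, comp_polyX).
  rewrite !(comp_polyZ, comp_polyX, comp_Xn_poly) -!mul_polyC.
  have -> : s%:P = (c / a * b / a)%:P by congr polyC; rewrite /s; field.
  have -> : c%:P = (c / a)%:P * a%:P by rewrite -polyCM divfK.
  rewrite !polyCM -/e; ring: ae.
have fE : f \Po (f \Po f) = (a / c) *: (T \Po (T \Po T) \Po l).
  have lE p : l \Po p = (c / a) *: p by rewrite comp_polyZ comp_polyX.
  rewrite -!comp_polyA -lf (comp_polyA T l) -lf -comp_polyA (comp_polyA T l).
  rewrite -lf -comp_polyA lE scalerA mulrA divfK // divff //.
  by rewrite scale1r.
(* Substituting [l], of degree 1, preserves sizes and carries a factorization of the third iterate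
   of [T] over to [f]. *)
have splits (u : F) (G H : {poly F}) : T \Po (T \Po T) = u%:P * (G * H) ->
    (1 < size G)%N -> (1 < size H)%N -> False.
  move=> TE G1 H1; move: irr; rewrite fE TE mul_polyC comp_polyZ.
  rewrite scalerA comp_polyM scalerAl => irr'.
  apply: irreducible_polyM (irr') _ _.
    rewrite size_scale ?size_comp_poly2 //; apply/eqP => k0.
    by have := irredp_neq0 irr'; rewrite k0 scale0r mul0r eqxx.
  by rewrite size_comp_poly2.
have sT : (1 < size T)%N.
  (* Index 1 selects the coefficient of ['X^2], here [a]. *)
  apply: (@coefS_size_gt1 _ _ 1).
  by rewrite /T !coefE /= !addr0 mulr1.
have compT (p : {poly F}) : T \Po p = a%:P * (p ^+ 2 + p + s%:P).
  by rewrite /T !(comp_polyM, comp_polyD, comp_polyC, comp_polyX, comp_Xn_poly).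
have [/artin_schreierP[r hr]|sI] := boolP (s \in artin_schreier F).
  (* The outermost [T] is [a] times the product of the linear factors at [r] and [r + 1]. *)
  apply: (@splits a (('X + r%:P) \Po (T \Po T))
                    (('X + (r + 1)%:P) \Po (T \Po T))).
  - rewrite -comp_polyM -[a%:P](comp_polyC _ (T \Po T)) -comp_polyM.
    congr (_ \Po _); rewrite /T -hr polyCD rmorphXn polyCD.
    by congr (_ * _); ring: P2.
  - by rewrite !size_comp_poly_gt1 ?size_XaddC.
  - by rewrite !size_comp_poly_gt1 ?size_XaddC.
have [/artin_schreierP[w0 hw0]|eI] := boolP (e \in artin_schreier F).
  (* Replacing [w0] by [w0 + 1] adds [s], which is outside the image, so one of the two roots
     works. *)
  have [w [hw /artin_schreierP[y hy]]] : exists w,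
      w ^+ 2 + w = e /\ s + s * w ^+ 2 \in artin_schreier F.
    have [h|h] := boolP (s + s * w0 ^+ 2 \in artin_schreier F).
      by exists w0.
    exists (w0 + 1); split; first exact: artin_schreier_eq_add1.
    have -> : s + s * (w0 + 1) ^+ 2 =
        s + (s + s * w0 ^+ 2) + 2 * (s * w0) by ring.
    rewrite F2 mul0r addr0.
    exact: artin_schreier_index2.
  pose Q x : {poly F} := 'X ^+ 2 + w%:P * 'X + s%:P + (w%:P + 1) * x.
  have sQ x : (1 < size (Q x%:P))%N.
    apply: (@coefS_size_gt1 _ _ 1); rewrite /Q !coefE /=.
    by rewrite !(mulr0, mul0r, addr0) oner_neq0.
  apply: (@splits (a ^+ 3) (Q y%:P \Po T) (Q (y + 1)%:P \Po T)).
  - rewrite -comp_polyM -[(a ^+ 3)%:P](comp_polyC _ T) -comp_polyM.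
    (* Writing the inner [T] as [T \Po 'X] lets [compT] reach the shape of the lemma, taken in
       [{poly F}] at [t = 'X]. *)
    rewrite comp_polyA -[T in T \Po T]comp_polyXr !compT rmorphXn polyCD.
    congr (_ \Po _); apply: (second_iterate_factor _ P2) => //.
      by rewrite -rmorphXn -polyCD hw.
    by rewrite -!rmorphXn -polyCM -!polyCD hy.
  - by rewrite size_comp_poly_gt1.
  - by rewrite size_comp_poly_gt1.
(* The same exchange of roots, for [d] and then for [g], now adds [e], which is outside the
   image. *)
have [d [hd /artin_schreierP[g0 hg0]]] : exists d,
    d ^+ 2 + d = s + e /\ s + e * d \in artin_schreier F.
  have /artin_schreierP[d0 hd0] := artin_schreier_index2 _ F2 _ _ sI eI.
  have [h|h] := boolP (s + e * d0 \in artin_schreier F).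
    by exists d0.
  exists (d0 + 1); split; first exact: artin_schreier_eq_add1.
  rewrite mulrDr mulr1 addrA.
  exact: artin_schreier_index2.
have [g [hg /artin_schreierP[k hk]]] : exists g, g ^+ 2 + g = s + e * d /\
    e ^+ 3 + e ^+ 2 + s + e * g \in artin_schreier F.
  have [h|h] := boolP (e ^+ 3 + e ^+ 2 + s + e * g0 \in artin_schreier F).
    by exists g0.
  exists (g0 + 1); split; first exact: artin_schreier_eq_add1.
  rewrite mulrDr mulr1 addrA.
  exact: artin_schreier_index2.
pose A x : {poly F} := 'X ^+ 2 + s%:P + e%:P ^+ 2 + e%:P * g%:P + x.
pose Q x : {poly F} := A x ^+ 2 + A x * ('X + x) + e%:P * ('X + x) ^+ 2.
have sQ x : (1 < size (Q x%:P))%N.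
  apply: (@coefS_size_gt1 _ _ 3).
  (* Expanding around the constant part [v] of [A x] exposes the leading coefficient 1 at ['X^4]. *)
  pose v := s + e ^+ 2 + e * g + x.
  have -> : Q x%:P = 'X^4 + 'X^3 + (2 * v + x + e)%:P * 'X^2
      + (v + 2 * e * x)%:P * 'X + (v ^+ 2 + v * x + e * x ^+ 2)%:P.
    by rewrite /Q /A /v; ring.
  by rewrite !coefE /= !mulr0 !addr0 oner_neq0.
apply: (@splits (a ^+ 7) (Q k%:P) (Q (k + 1)%:P)) => //.
rewrite -[T in T \Po (T \Po T)]comp_polyXr !compT rmorphXn polyCD.
apply: (third_iterate_factor _ P2 _ _ _ d%:P) => //.
- by rewrite -rmorphXn -!polyCD hd.
- by rewrite -rmorphXn -!(polyCM, polyCD) hg.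
- by rewrite -!rmorphXn -!(polyCM, polyCD) hk.
Qed.
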